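(* Let $n\ge 1$ and let $P(\lambda)=\lambda^2 A_2+\lambda A_1+A_0$ with $A_0,A_1,A_2\in\mathbb{C}^{n\times n}$, and set $\gamma_i:=\|A_i\|$ for $i=0,1,2$. Assume that $A_2$ is invertible and that the max-times polynomial $p(\lambda)=\max(\gamma_2\lambda^2,\gamma_1\lambda,\gamma_0)$ has two distinct tropical roots, $\alpha^+:=\gamma_1/\gamma_2$ and $\alpha^-:=\gamma_0/\gamma_1$ (so that $\alpha^+>\alpha^-$, i.e. $\gamma_1^2>\gamma_0\gamma_2$). Let $\delta:=\alpha^+/\alpha^-$. Let $\xi_1,\dots,\xi_n$ denote the eigenvalues, counted with multiplicities, of the pencil $\lambda A_2+A_1$, and set $\xi_{n+1}=\cdots=\xi_{2n}=0$; write $\xi=(\xi_1,\dots,\xi_{2n})$. Then \[ v(\operatorname{spec}P,\xi)\le \frac{C\,\alpha^+}{\delta^{1/(2n)}}, \] where \[ C:=4\times 2^{-1/(2n)}\Big(2+2\operatorname{cond}A_2+\frac{\operatorname{cond}A_2}{\delta}\Big)^{1-1/(2n)}\big(\operatorname{cond}A_2\big)^{1/(2n)}, \] and \[ \alpha^+(\operatorname{cond}A_1)^{-1}\le|\xi_i|\le\alpha^+\operatorname{cond}A_2,\qquad 1\le i\le n. \]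
   Context: $\|\cdot\|$ is the matrix norm on $\mathbb{C}^{n\times n}$ induced by the Euclidean norm (the spectral norm). For an invertible matrix $A$, $\operatorname{cond}A:=\|A\|\,\|A^{-1}\|$; if $A$ is singular, $\operatorname{cond}A=+\infty$ and $(\operatorname{cond}A)^{-1}=0$. The eigenvalues of a matrix polynomial $P(\lambda)$ are the solutions of $\det P(\lambda)=0$. The sequence of eigenvalues counted with multiplicities (as roots of $\det P(\lambda)$) is denoted $\operatorname{spec}P$; here, since $A_2$ is invertible, $\operatorname{spec}P$ consists of $2n$ complex numbers. Similarly the eigenvalues of the pencil $\lambda A_2+A_1$ are the $n$ roots of $\det(\lambda A_2+A_1)$ counted with multiplicities. For two sequences $\lambda=(\lambda_1,\dots,\lambda_m)$ and $\mu=(\mu_1,\dots,\mu_m)$ of complex numbers, the variation between them is \[ v(\lambda,\mu):=\min_{\pi\in S_m}\ \max_{1\le i\le m}|\mu_{\pi(i)}-\lambda_i|, \] where $S_m$ is the set of permutations of $\{1,\dots,m\}$. The tropical roots of a max-times polynomial $\max_{0\le k\le d}\gamma_k x^k$ with nonnegative real coefficients are the points $x\ge 0$ at which the maximum is attained at least twice. In the case at hand, $p$ has two distinct tropical roots exactly when $\gamma_1^2>\gamma_0\gamma_2$, and then they are $\gamma_1/\gamma_2$ and $\gamma_0/\gamma_1$. If $\gamma_0=0$, then $\alpha^-=0$, and one uses the convention $\delta=+\infty$, $1/\delta=0$ and $\delta^{-1/(2n)}=0$. *)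

(* Defs.v *)
From HB Require Import structures.
From mathcomp Require Import all_boot all_order all_algebra all_fingroup.
From mathcomp Require Export complex.
From mathcomp Require Import all_classical all_reals all_analysis.

Set Implicit Arguments.
Unset Strict Implicit.
Unset Printing Implicit Defensive.

Import Order.TTheory GRing.Theory Num.Theory.
Local Open Scope classical_set_scope.
Local Open Scope ring_scope.

Section MatrixNorm.
Variable R : realType.

Definition l2norm n (x : 'cV[R[i]]_n) : R :=
  Num.sqrt (\sum_(i < n) Normc.normc (x i 0) ^+ 2).

Definition spectral_norm n (A : 'M[R[i]]_n) : R :=
  sup [set l2norm (A *m x) | x in [set x : 'cV[R[i]]_n | l2norm x <= 1]].

Definition cond n (A : 'M[R[i]]_n) : \bar R :=
  if A \in unitmx then (spectral_norm A * spectral_norm (invmx A))%:E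
  else +oo%E.

End MatrixNorm.

Section Spectrum.
Variable R : realType.

Definition lin_pencil n (A1 A0 : 'M[R[i]]_n) : 'M[{poly R[i]}]_n :=
  'X *: map_mx polyC A1 + map_mx polyC A0.

Definition quad_poly n (A2 A1 A0 : 'M[R[i]]_n) : 'M[{poly R[i]}]_n :=
  'X^2 *: map_mx polyC A2 + 'X *: map_mx polyC A1 + map_mx polyC A0.

(* [s] lists, in some order, the roots of [\det P] with their multiplicities
   (meaningful for [\det P != 0]); in particular [m] is the degree of
   [\det P]. *)
Definition is_spec n (P : 'M[{poly R[i]}]_n) m (s : m.-tuple R[i]) : Prop :=
  forall z : R[i], count_mem z s = mup z (\det P).

Definition matching_dist m (s t : m.-tuple R[i]) (pi : 'S_m) : R :=
  \big[Num.max/0]_(i < m) Normc.normc (tnth t (pi i) - tnth s i).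

(* The default value of the minimum is one of the values minimized over. *)
Definition spec_variation m (s t : m.-tuple R[i]) : R :=
  \big[Num.min/matching_dist s t 1%g]_(pi : 'S_m) matching_dist s t pi.

End Spectrum.

(* Tropical roots of [max_(k <= d) c_k * x ^+ k]. *)
Definition tropical_root (R : realType) d (c : d.+1.-tuple R) (x : R) : Prop :=
  0 <= x /\
  exists i j : 'I_d.+1,
    [/\ i != j,
        forall k : 'I_d.+1, tnth c k * x ^+ k <= tnth c i * x ^+ i &
        forall k : 'I_d.+1, tnth c k * x ^+ k <= tnth c j * x ^+ j].

(* Main.v *)
Require Import Defs.
From mathcomp Require Import all_boot all_order all_algebra.
From mathcomp Require Import all_classical all_reals all_analysis.
From mathcomp Require Import perm cyclic separable cyclotomic.
From mathcomp Require Import ring lra.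

(** The roots of [\det P] are the eigenvalues of the block companion matrix
    [M = ((0, a), (- A0' / a, - A1'))], where [A0' = A2^-1 A0],
    [A1' = A2^-1 A1] and [a] is the larger tropical root; the [xi_i] completed
    by [n] zeros are the eigenvalues of the matrix [M0] obtained from [M] by
    deleting [A0'].  The scaling by [a] balances the blocks: with
    [k = cond A2] and [q = 1 / delta], the norms of [M0], [M] and [M - M0] are
    at most [a (1 + k)], [a (1 + k + k q)] and [a k q].  The first claim is
    therefore the case [N = 2 n] of a perturbation bound of Bhatia, Elsner and
    Krause ([eigenvalue_matching]): the eigenvalues of two matrices [A] and
    [B] of order [N] can be matched so that every distance [d] between partners
    satisfies [2 (d / 4)^N <= r], where [r = |B - A| (|A| + |B|)^(N - 1)].

    To prove that bound, let [p] be the characteristic polynomial of [A] and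
    follow the segment from [A] to [B].  If [z] is an eigenvalue of
    [A + x (B - A)] with unit eigenvector [v], then [(z - A) v = x (B - A) v]
    is short, and a matrix of norm at most [m] that maps a unit vector to a
    vector of norm [h] has a determinant of modulus at most [h m^(N - 1)]
    ([det_le_mx_bound]).  This gives [|p z| <= r]: all eigenvalues met on the
    way lie in the lemniscate [|p| <= r].  As they move continuously, an
    eigenvalue of [A] is joined to its partner inside that lemniscate, and
    two points at distance [d] in a connected set where [|p| <= r] satisfy
    [2 (d / 4)^N <= r].  For this last fact, project the set and the roots of
    [p] onto the line through the two points: this does not increase [|p|],
    and a real monic polynomial of degree [N] reaches the modulus
    [2 (d / 4)^N] on every segment of length [d] ([chebyshev_segment]).

    No continuous choice of the eigenvalues is needed.  Connected sets are
    replaced by finite chains of points with steps at most [h]: the roots of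
    two monic polynomials with close coefficients can be matched closely
    ([match_close_roots]), so cutting the segment finely yields such chains
    ([chained_matching]), along which the distance estimate holds up to an
    error [O(h)] ([chained_dist_le]).  There are finitely many matchings, so
    one of them serves for arbitrarily small [h] ([finite_limit_choice]).

    The bounds on the [xi_i] come from applying norms to
    [A2^-1 A1 v = - xi_i v] and to [v = - xi_i A1^-1 A2 v]. *)

Set Implicit Arguments.
Unset Strict Implicit.
Unset Printing Implicit Defensive.

Import Order.TTheory GRing.Theory Num.Theory Normc.
Local Open Scope ring_scope.

(** * The modulus of complex numbers and Chebyshev's extremal bound *)

Section Modulus.
Variable R : realType.
Implicit Types (x y z : R[i]) (a : R).

Lemma normCE z : `|z| = (normc z)%:C%C.
Proof. by case: z. Qed.

Lemma normc_ge0 z : 0 <= normc z.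
Proof. by rewrite -lecR -normCE normr_ge0. Qed.

Lemma normcD x y : normc (x + y) <= normc x + normc y.
Proof. exact: le_normcD. Qed.

Lemma normc_opp z : normc (- z) = normc z.
Proof. exact: normcN. Qed.

Lemma normcBC x y : normc (x - y) = normc (y - x).
Proof. by rewrite -normc_opp opprB. Qed.

Lemma normc_real a : normc a%:C%C = `|a|.
Proof. by rewrite /= expr0n /= addr0 sqrtr_sqr. Qed.

Lemma normc_Re z : `|complex.Re z| <= normc z.
Proof. by rewrite -lecR -normCE normc_ge_Re. Qed.

Lemma normc_prod I (r : seq I) (P : pred I) (F : I -> R[i]) :
  normc (\prod_(i <- r | P i) F i) = \prod_(i <- r | P i) normc (F i).
Proof. by apply: (big_morph _ (@normcM R)); exact: normc1. Qed.

Lemma normcX z n : normc (z ^+ n) = normc z ^+ n.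
Proof. by elim: n => [|n IH]; rewrite ?expr0 ?normc1 // !exprS normcM IH. Qed.

Lemma normc_sum I (r : seq I) (P : pred I) (F : I -> R[i]) :
  normc (\sum_(i <- r | P i) F i) <= \sum_(i <- r | P i) normc (F i).
Proof.
elim/big_rec2: _ => [|i u v _ le_uv]; first by rewrite normc0.
by apply: le_trans (normcD _ _) _; rewrite lerD2l.
Qed.

Lemma normc_eq0 z : (normc z == 0) = (z == 0).
Proof. by apply/eqP/eqP => [/eq0_normc|->]; rewrite ?normc0. Qed.

End Modulus.

Section Chebyshev.

Lemma complex_prim_root (R : rcfType) M :
  (0 < M)%N -> exists w : R[i], M.-primitive_root w.
Proof.
move=> M_gt0; pose p : {poly R[i]} := 'X^M - 1.
have [r Dp] := closed_field_poly_normal p.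
rewrite (monicP _) ?monicXnsubC // scale1r in Dp.
have rn1 : all M.-unity_root r by apply/allP=> z; rewrite -root_prod_XsubC -Dp.
have sz_r : (M < (size r).+1)%N.
  by rewrite -(size_prod_XsubC r id) -Dp size_XnsubC.
have [|w _ prim_w] := hasP (has_prim_root M_gt0 rn1 _ sz_r); last by exists w.
by rewrite -separable_prod_XsubC -Dp separable_Xn_sub_1 // pnatr_eq0 -lt0n.
Qed.

Lemma sum_prim_root_expr (F : fieldType) (w : F) M j :
  M.-primitive_root w -> ~~ (M %| j)%N -> \sum_(k < M) (w ^+ k) ^+ j = 0.
Proof.
move=> prim_w; rewrite (prim_order_dvd prim_w) => wj1.
have wj1' : w ^+ j - 1 != 0 by rewrite subr_eq0.
apply: (mulfI wj1'); rewrite mulr0.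
under eq_bigr do rewrite -exprM mulnC exprM.
by rewrite -subrX1 -exprM mulnC exprM (prim_expr_order prim_w) expr1n subrr.
Qed.

(** Summing over all powers of [w] annihilates every monomial whose degree is
    not a multiple of [M]; up to degree [M], the two end coefficients remain. *)
Lemma sum_poly_prim_root (F : fieldType) (w : F) M (Q : {poly F}) :
  M.-primitive_root w -> (size Q <= M.+1)%N ->
  \sum_(k < M) Q.[w ^+ k] = (Q`_0 + Q`_M) *+ M.
Proof.
case: M => [|M] prim_w sQ; first by have := prim_order_gt0 prim_w.
under eq_bigr do rewrite (horner_coef_wide _ sQ).
rewrite exchange_big /=; under eq_bigr do rewrite -mulr_sumr.
rewrite big_ord_recl [X in _ + X]big_ord_recr /=.
rewrite [X in _ + (X + _)]big1 => [|k _]; last first.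
  by rewrite (sum_prim_root_expr prim_w) ?mulr0 // gtnNdvd //= /bump ltnS ltn_ord.
have w1 (k : 'I_M.+1) : (w ^+ k) ^+ M.+1 = 1.
  by rewrite -exprM mulnC exprM (prim_expr_order prim_w) expr1n.
under eq_bigr do rewrite expr0.
under [X in _ + (_ + _ * X)]eq_bigr do rewrite /bump /= add1n w1.
by rewrite !sumr_const card_ord add0r -mulrDl mulr_natr.
Qed.

(** On the unit circle [Re z = (z + 1 / z) / 2], so [z^N] times the value at
    [Re z] of the product is a polynomial [Q] in [z], of degree [2 N], whose
    constant and leading coefficients are both [2^-N].  The mean of [Q] over
    the roots of unity of order [2 N] is the sum [2 / 2^N] of these two
    coefficients, so [|Q|] is at least as large at one of them. *)
Lemma chebyshev_unit (R : realType) (s : seq R) : (0 < size s)%N ->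
  exists2 x, -1 <= x <= 1 & 2 / 2 ^+ size s <= `|\prod_(c <- s) (x - c)|.
Proof.
move=> s_gt0; set N := size s; pose M := (2 * N)%N.
have M_gt0 : (0 < M)%N by rewrite muln_gt0.
have [w prim_w] := complex_prim_root R M_gt0.
pose q (c : R) : {poly R[i]} := 2^-1 *: 'X^2 - (c%:C%C) *: 'X + 2^-1%:P.
have n2 : (2 : R[i]) != 0 by rewrite pnatr_eq0.
have sq c : size (q c) = 3 /\ lead_coef (q c) = 2^-1.
  have s1 : size (2^-1 *: 'X^2 : {poly R[i]}) = 3.
    by rewrite size_scale ?invr_eq0 // size_polyXn.
  have s2 : (size (- (c%:C%C *: 'X) + 2^-1%:P : {poly R[i]})%R < 3)%N.
    rewrite (leq_ltn_trans (size_polyD _ _)) // gtn_max size_polyN.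
    rewrite (leq_ltn_trans (size_scale_leq _ _)) ?size_polyX //=.
    by rewrite (leq_ltn_trans (size_polyC_leq1 _)).
  by rewrite /q -addrA size_polyDl ?s1 // lead_coefDl ?s1 // lead_coefZ
    lead_coefXn mulr1.
pose Q := \prod_(c <- s) q c.
have [sQ lQ] : size Q = M.+1 /\ lead_coef Q = 2^-1 ^+ N.
  rewrite /Q /M /N; elim: (s) => [|c t [IH1 IH2]].
    by rewrite big_nil size_poly1 lead_coef1 muln0 expr0.
  rewrite big_cons lead_coefM IH2 size_proper_mul.
    by have [-> ->] := sq c; rewrite IH1 /= !exprS; rewrite mulnS.
  have [_ ->] := sq c; rewrite IH2 mulf_neq0 ?expf_neq0 ?invr_eq0 //.
have Q0 : Q`_0 = 2^-1 ^+ N.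
  rewrite -horner_coef0 /Q /N; elim: (s) => [|c t IH].
    by rewrite big_nil hornerE expr0.
  rewrite big_cons hornerM IH /q hornerD hornerC hornerD hornerN !hornerZ.
  by rewrite hornerX hornerXn expr0n /= !mulr0 subr0 add0r exprS.
have QM : Q`_M = 2^-1 ^+ N by rewrite -lQ lead_coefE sQ.
have Qw (z : R[i]) : normc z = 1 ->
    normc Q.[z] = `|\prod_(c <- s) (complex.Re z - c)|.
  move=> z1; rewrite horner_prod normc_prod normr_prod; apply: eq_bigr => c _.
  have zzJ : z * z^*%C = 1 by rewrite -sqr_normc normCE z1 expr1n.
  have -> : (q c).[z] = z * (complex.Re z - c)%:C%C.
    rewrite rmorphB /= ReJ_add /q hornerD hornerC hornerD hornerN !hornerZ.
    rewrite hornerX hornerXn -[in LHS](mulr1 2^-1) -[X in _ - _ + _ * X]zzJ.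
    by field.
  by rewrite normcM z1 mul1r normc_real.
apply: contrapT => nH; have H (x : R) : -1 <= x <= 1 ->
    `|\prod_(c <- s) (x - c)| < 2 / 2 ^+ N.
  by move=> x1; rewrite ltNge; apply/negP => le; apply: nH; exists x.
have := sum_poly_prim_root prim_w; move/(_ Q); rewrite sQ => /(_ (leqnn _)).
rewrite Q0 QM => /(congr1 (@normc R)).
have w1 k : normc (w ^+ k) = 1.
  have: normc w ^+ M = 1 by rewrite -normcX (prim_expr_order prim_w) normc1.
  move/eqP; rewrite pexpr_eq1 ?normc_ge0 // => /eqP nw1.
  by rewrite normcX nw1 expr1n.
have -> : (2^-1 ^+ N + 2^-1 ^+ N) *+ M = ((2 / 2 ^+ N) *+ M)%:C%C :> R[i].
  rewrite -mulr2n -mulr_natl exprVn !rmorphMn /= rmorphM fmorphV rmorphXn /=.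
  by rewrite (rmorph_nat (real_complex R)) mulr_natl -[2 ^- N *+ 2]mulr_natl.
rewrite normc_real ger0_norm ?mulrn_wge0 ?divr_ge0 ?exprn_ge0 //.
apply/eqP; rewrite lt_eqF //.
apply: le_lt_trans (normc_sum _ _ _) _.
have -> : (2 / 2 ^+ N) *+ M = \sum_(k < M) (2 / 2 ^+ N) :> R.
  by rewrite sumr_const card_ord.
apply: ltr_sum => [|k _].
  by apply/hasP; exists (Ordinal M_gt0); rewrite ?mem_index_enum.
rewrite Qw // H //.
by rewrite -ler_norml (le_trans (normc_Re _)) // w1.
Qed.

Lemma chebyshev_segment (R : realType) (s : seq R) (L : R) :
  (0 < size s)%N -> 0 < L ->
  exists2 x, 0 <= x <= L &
    2 * (L / 4) ^+ size s <= `|\prod_(c <- s) (x - c)|.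
Proof.
move=> s_gt0 L_gt0; have L0 : L != 0 by rewrite gt_eqF.
pose t := [seq 2 * c / L - 1 | c <- s].
have [|x /andP[x1 x2]] := @chebyshev_unit _ t; first by rewrite size_map.
rewrite size_map => le_x; exists (L / 2 * (1 + x)).
  by apply/andP; split; nra.
have -> : \prod_(c <- s) (L / 2 * (1 + x) - c) =
          (L / 2) ^+ size s * \prod_(c <- t) (x - c).
  rewrite /t big_map; elim: (s) => [|c u IH]; first by rewrite !big_nil mulr1.
  by rewrite !big_cons IH exprS; field.
rewrite normrM ger0_norm ?exprn_ge0 ?divr_ge0 ?(ltW L_gt0) //.
apply: le_trans (ler_wpM2l _ le_x); last by rewrite exprn_ge0 ?divr_ge0 ?(ltW L_gt0).
rewrite mulrCA -exprVn -exprMn ler_pM2l // le_eqVlt; apply/orP; left; apply/eqP.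
by congr (_ ^+ _); field.
Qed.

End Chebyshev.

(** * Chains in a lemniscate *)

Section Chains.
Variable R : realType.

Definition step_le (h : R) : rel R[i] := fun u v => normc (u - v) <= h.

(** A discrete substitute for lying in the same connected component of [D]. *)
Definition chained (h : R) (D : pred R[i]) (x y : R[i]) :=
  exists p, [/\ path (step_le h) x p, all D (x :: p) & last x p = y].

Lemma chained_refl h (D : pred R[i]) x : D x -> chained h D x x.
Proof. by move=> Dx; exists [::]; rewrite /= Dx. Qed.

Lemma chained_rcons h (D : pred R[i]) x y z :
  chained h D x y -> normc (y - z) <= h -> D z -> chained h D x z.
Proof.
case=> p [pp Dp <-] yz Dz; exists (rcons p z).
by rewrite rcons_path -rcons_cons all_rcons last_rcons pp Dp Dz.
Qed.

(** Somewhere the chain steps over the level [t]; the point before that step is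
    the one needed. *)
Lemma path_discrete_ivt h (f : R[i] -> R) (t : R) x p :
  0 <= h -> (forall u v, `|f u - f v| <= normc (u - v)) ->
  path (step_le h) x p -> f x <= t <= f (last x p) ->
  exists2 w, w \in x :: p & `|f w - t| <= h.
Proof.
move=> h_ge0 lipf; elim: p x => [|y p IH] x /=.
  move=> _ /le_anti <-; exists x; rewrite ?mem_head // subrr normr0 //.
case/andP=> xy pp /andP[le1 le2]; have [le3|lt3] := leP (f y) t.
  have [|w wp le_w] := IH y pp; first by rewrite le3.
  by exists w => //; rewrite inE wp orbT.
exists x; rewrite ?mem_head // distrC ger0_norm ?subr_ge0 //.
apply: le_trans xy; apply: le_trans (lipf x y).
by rewrite distrC ler_normr; apply/orP; left; rewrite lerD2r ltW.
Qed.

(** The dependence on [h] matters here: the error vanishes with [h], uniformly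
    over the sequences bounded by [U]. *)
Lemma prod_shift_le (s : seq R) (U h : R) :
  0 <= h <= 1 -> (forall u, u \in s -> 0 <= u <= U) ->
  \prod_(u <- s) (u + h) <=
    \prod_(u <- s) u + h * ((size s)%:R * (U + 1) ^+ size s).
Proof.
move=> /andP[h0 h1]; elim: s => [|u s IH] sU.
  by rewrite !big_nil mul0r mulr0 addr0.
have /andP[u0 uU] := sU u (mem_head _ _).
have {}sU v : v \in s -> 0 <= v <= U by move=> vs; rewrite sU // inE vs orbT.
have {}IH := IH sU; rewrite !big_cons.
have prod_le : \prod_(v <- s) (v + h) <= (U + 1) ^+ size s.
  rewrite -[size s]count_predT -iter_mulr_1 -big_const_seq big_seq.
  rewrite [X in _ <= X]big_seq; apply: ler_prod => v /sU /andP[v0 vU].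
  by rewrite addr_ge0 // lerD.
set P := \prod_(v <- s) v in IH *; set Ph := \prod_(v <- s) _ in IH prod_le *.
set K := (U + 1) ^+ size s in IH prod_le *.
have U1 : 0 <= U by apply: le_trans uU.
have K0 : 0 <= K by rewrite exprn_ge0 // addr_ge0.
rewrite exprS -/K -[(size (u :: s))%:R]natr1.
set n := (size s)%:R in IH *; have n0 : 0 <= n by rewrite ler0n.
have e1 : u * Ph <= u * (P + h * (n * K)) by rewrite ler_wpM2l.
have e2 : h * Ph <= h * K by rewrite ler_wpM2l.
have e3 : u * (h * (n * K)) <= U * (h * (n * K)) by rewrite ler_wpM2r ?mulr_ge0.
have e4 : 0 <= h * (n * K) by rewrite !mulr_ge0.
have e5 : 0 <= U * (h * K) by rewrite !mulr_ge0.
rewrite mulrDl; apply: le_trans (lerD e1 e2) _.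
rewrite mulrDr -!addrA lerD2l; nra.
Qed.

(** Project onto the line through [x] and [y].  The images of the points of the
    chain are [h]-dense in the segment between them, and at a point where the
    projected monic polynomial is large, Chebyshev's bound passes to a nearby
    point of the chain with a loss of at most [h] in every factor. *)
Lemma chained_dist_le (a : seq R[i]) (M h r : R) x y :
  (0 < size a)%N -> 0 <= h <= 1 -> (forall c, c \in a -> normc c <= M) ->
  chained h (fun w => (normc w <= M) && (normc (\prod_(c <- a) (w - c)) <= r))
    x y ->
  2 * (normc (y - x) / 4) ^+ size a <=
    r + h * ((size a)%:R * (2 * M + 1) ^+ size a).
Proof.
move=> a_gt0 h01 aM [p [pp /allP Dp <-]]; set y' := last x p.
have /andP[h0 h1] := h01.
have /andP[xM xr] := Dp x (mem_head _ _).
have M0 : 0 <= M by apply: le_trans xM; exact: normc_ge0.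
have [->|] := eqVneq y' x.
  rewrite subrr normc0 mul0r expr0n gtn_eqF // mulr0.
  rewrite addr_ge0 //; first by apply: le_trans xr; exact: normc_ge0.
  by rewrite !mulr_ge0 ?exprn_ge0 ?addr_ge0 // mulr_ge0.
rewrite -subr_eq0 -normc_eq0; set L := normc (y' - x) => L_neq0.
have L_gt0 : 0 < L by rewrite lt_def L_neq0 normc_ge0.
(* [f] is the orthogonal projection onto the line from [x] to [y'], with [x]
   as origin. *)
pose u : R[i] := (y' - x)^*%C * (L^-1)%:C%C.
have nu : normc u = 1.
  rewrite /u normcM normc_real ger0_norm ?invr_ge0 ?ltW //.
  suff -> : normc (y' - x)^*%C = L by rewrite divff.
  by apply: complexI; rewrite -normCE normcJ normCE.
pose f w := complex.Re (u * (w - x)).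
have lipf v w : `|f v - f w| <= normc (v - w).
  rewrite /f -raddfB -mulrBr /=; apply: le_trans (normc_Re _) _.
  by rewrite normcM nu mul1r opprB addrA subrK.
have fx : f x = 0 by rewrite /f subrr mulr0.
have fy : f y' = L.
  rewrite /f /u mulrAC [_^*%C * _]mulrC -sqr_normc normCE -/L -rmorphXn -rmorphM.
  by rewrite /= expr2 mulfK.
have [|t /andP[t0 tL]] := @chebyshev_segment _ (map f a) L _ L_gt0.
  by rewrite size_map.
rewrite size_map => le_t.
have [|w wp le_w] := path_discrete_ivt (t := t) h0 lipf pp.
  by rewrite fx fy t0.
have /andP[wM wr] := Dp w wp.
pose dists := [seq normc (w - c) | c <- a].
apply: le_trans le_t _; apply: le_trans (_ : \prod_(v <- dists) (v + h) <= _).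
  rewrite normr_prod !big_map; apply: ler_prod => c _; rewrite normr_ge0 /=.
  have -> : t - f c = (f w - f c) - (f w - t) by ring.
  by apply: le_trans (ler_normB _ _) _; rewrite lerD.
apply: le_trans (prod_shift_le (U := 2 * M) h01 _) _.
  move=> _ /mapP[c /aM cM ->]; rewrite normc_ge0 /=.
  apply: le_trans (normcD _ _) _; rewrite normc_opp; lra.
by rewrite size_map lerD2r big_map -normc_prod.
Qed.

End Chains.

(** * Continuity of the roots of a polynomial *)

Section RootContinuity.
Variable R : realType.
Local Notation C := R[i].
Implicit Types (a b : seq C) (M h d : R).

Definition monic_of_roots a : {poly C} := \prod_(c <- a) ('X - c%:P).

(** The coefficients of the quotient are determined from the top one downwards
    by [r_k = s_(k+1) + c r_(k+1)], which multiplies a bound by at most [M] and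
    adds [d]. *)
Lemma coef_XsubC_div (r : {poly C}) c M d m :
  1 <= M -> normc c <= M -> (size r <= m)%N ->
  (forall k, normc (('X - c%:P) * r)`_k <= d) ->
  forall k, normc r`_k <= d * (m%:R * M ^+ m).
Proof.
move=> M1 cM sr le_d.
have d0 : 0 <= d by apply: le_trans (le_d 0%N); exact: normc_ge0.
have M0 : 0 <= M by apply: le_trans M1.
suff H j k : (m <= k + j)%N -> normc r`_k <= d * (j%:R * M ^+ j).
  by move=> k; apply: H; rewrite leq_addl.
elim: j k => [|j IH] k le_m.
  by rewrite addn0 in le_m; rewrite nth_default ?(leq_trans sr) // normc0 mul0r mulr0.
have -> : r`_k = (('X - c%:P) * r)`_k.+1 + c * r`_k.+1.
  by rewrite mulrBl coefB coefXM coefCM /= subrK.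
apply: le_trans (normcD _ _) _.
have IHk : normc r`_k.+1 <= d * (j%:R * M ^+ j) by apply: IH; rewrite addSnnS.
rewrite normcM -natr1 exprS.
have e1 : normc c * normc r`_k.+1 <= M * (d * (j%:R * M ^+ j)).
  by apply: ler_pM => //; exact: normc_ge0.
have e2 : d <= d * (M * M ^+ j).
  by rewrite ler_peMr // -exprS exprn_ege1.
apply: le_trans (lerD (le_trans (le_d _) e2) e1) _.
rewrite le_eqVlt; apply/orP; left; apply/eqP; ring.
Qed.

Lemma coef_monic_of_roots b M : 0 <= M -> (forall c, c \in b -> normc c <= M) ->
  forall k, normc (monic_of_roots b)`_k <= (1 + M) ^+ size b.
Proof.
rewrite /monic_of_roots => M0; elim: b => [|c b IH] bM k.
  rewrite big_nil coef1 expr0; case: (k == 0)%N; first by rewrite normc1.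
  by rewrite normc0 ler01.
have {}IH := IH (fun v vb => bM v (@mem_behead _ (c :: b) v vb)).
have cM := bM c (mem_head _ _).
have IH0 : 0 <= (1 + M) ^+ size b by rewrite exprn_ge0 // addr_ge0.
rewrite big_cons mulrBl coefB coefXM coefCM.
apply: le_trans (normcD _ _) _; rewrite normc_opp normcM exprS mulrDl mul1r.
apply: lerD; first by case: eqP => _; rewrite ?normc0 ?IH.
by apply: ler_pM => //; exact: normc_ge0.
Qed.

(** The product of the distances from [c] to the entries of [b] is the modulus
    at [c] of the second polynomial, which is small because the first one
    vanishes there; hence one of the factors is small. *)
Lemma near_root a b c M d n :
  1 <= M -> normc c <= M ->
  (forall k, normc (monic_of_roots a - monic_of_roots b)`_k <= d) ->
  size a = n.+1 -> size b = n.+1 -> c \in a ->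
  exists2 v, v \in b & normc (c - v) ^+ n.+1 <= d * (n.+2%:R * M ^+ n.+1).
Proof.
move=> M1 cM le_d sa sb ca; pose p := monic_of_roots a; pose q := monic_of_roots b.
have d0 : 0 <= d by apply: le_trans (le_d 0%N); exact: normc_ge0.
have M0 : 0 <= M by apply: le_trans M1.
have spq : (size (p - q)%R <= n.+2)%N.
  by rewrite (leq_trans (size_polyD _ _)) // size_polyN !size_prod_XsubC sa sb maxnn.
have pc : p.[c] = 0 by apply/eqP; rewrite -rootE root_prod_XsubC.
have le_q : normc q.[c] <= d * (n.+2%:R * M ^+ n.+1).
  rewrite -normc_opp -[- _]add0r -pc -hornerN -hornerD (horner_coef_wide _ spq).
  apply: le_trans (normc_sum _ _ _) _.
  apply: le_trans (_ : \sum_(i < n.+2) d * M ^+ n.+1 <= _).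
    apply: ler_sum => i _; rewrite normcM; apply: ler_pM; rewrite ?normc_ge0 //.
    rewrite normcX; apply: le_trans (_ : M ^+ i <= _).
      by rewrite lerXn2r ?nnegrE ?normc_ge0.
    by apply: ler_weXn2l => //; rewrite -ltnS.
  by rewrite sumr_const card_ord -[X in X <= _]mulr_natr -mulrA [_%:R * _]mulrC.
apply: contrapT => far.
have {}far v : v \in b -> d * (n.+2%:R * M ^+ n.+1) < normc (c - v) ^+ n.+1.
  by move=> vb; rewrite ltNge; apply/negP => le; apply: far; exists v.
move: le_q; set X := d * _ in far *.
have X0 : 0 <= X by rewrite mulr_ge0 ?mulr_ge0 ?exprn_ge0.
rewrite -(@ler_pXn2r _ n.+1) ?nnegrE ?normc_ge0 // leNgt => /negP; apply.
rewrite /q /monic_of_roots horner_prod normc_prod -prodrXl.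
rewrite -sb -[size b]count_predT -iter_mulr_1 -big_const_seq big_seq.
rewrite [X in _ < X]big_seq.
have [b0 b0b] : exists v, v \in b.
  by case: (b) sb => // v ? _; exists v; rewrite mem_head.
apply: ltr_prod => [|v vb]; first by apply/hasP; exists b0.
by rewrite X0 hornerXsubC count_predT sb /=; exact: far.
Qed.

(** Uniform continuity of the roots, by deflation: a root [c] of the first
    polynomial has a root [v] of the second one nearby, and dividing by
    [X - c] and [X - v] leaves polynomials with close coefficients, to which
    the induction hypothesis applies. *)
Lemma match_close_roots n M h : 1 <= M -> 0 < h ->
  exists2 d, 0 < d & forall a b, size a = n -> size b = n ->
    (forall c, c \in a -> normc c <= M) -> (forall c, c \in b -> normc c <= M) ->
    (forall k, normc (monic_of_roots a - monic_of_roots b)`_k <= d) ->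
    exists2 b', perm_eq b' b &
      forall i, (i < n)%N -> normc (nth 0 a i - nth 0 b' i) <= h.
Proof.
move=> M1 h0; have M0 : 0 < M by apply: lt_le_trans M1.
elim: n => [|n [d' d'0 IH]].
  by exists 1 => // a b _ /size0nil -> *; exists [::].
pose K := n.+1%:R * M ^+ n.+1; pose L := (1 + M) ^+ n.
have K0 : 0 < K by rewrite mulr_gt0 ?exprn_gt0.
have L0 : 0 < L by rewrite exprn_gt0 // addr_gt0.
(* [h'] bounds the distance between the two roots divided out; it and [d] are
   chosen so that each contributes at most [d' / 2] to the coefficients of the
   difference of the quotients, and [d] is small enough for [near_root] to
   yield the distance [h']. *)
pose h' := Num.min h (d' / (2 * K * L)).
have h'0 : 0 < h' by rewrite lt_min h0 divr_gt0 ?(mulr_gt0 (mulr_gt0 _ _)).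
pose K' := n.+2%:R * M ^+ n.+1.
have K'0 : 0 < K' by rewrite mulr_gt0 ?exprn_gt0.
pose d := Num.min (d' / (2 * K)) (h' ^+ n.+1 / K').
have d0 : 0 < d.
  rewrite lt_min (divr_gt0 d'0 (mulr_gt0 _ K0)) ?ltr0n //=.
  exact: divr_gt0 (exprn_gt0 _ h'0) K'0.
exists d => // -[//|c a] b sca sb aM bM le_d.
have cM := aM c (mem_head _ _).
have [v vb cv] := near_root M1 cM le_d sca sb (mem_head _ _).
have {}cv : normc (c - v) <= h'.
  rewrite -(@ler_pXn2r _ n.+1) ?nnegrE ?normc_ge0 ?(ltW h'0) //.
  apply: le_trans cv _; rewrite -/K' -ler_pdivlMr // /d ge_min lexx orbT //.
pose b1 := rem v b.
have pb : perm_eq (v :: b1) b by rewrite perm_sym perm_to_rem.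
have sb1 : size b1 = n by rewrite size_rem // sb.
have b1M u : u \in b1 -> normc u <= M by move=> /mem_rem; exact: bM.
have eqb : monic_of_roots b = ('X - v%:P) * monic_of_roots b1.
  by rewrite /monic_of_roots -(perm_big _ pb) /= big_cons.
have aM' u (ua : u \in a) : normc u <= M := aM u (@mem_behead _ (c :: a) u ua).
have [||b' pb' le_b'] := IH a b1 _ sb1 aM' b1M.
- by case: sca.
- have eq_r : ('X - c%:P) * (monic_of_roots a - monic_of_roots b1) =
      (monic_of_roots (c :: a) - monic_of_roots b) + (c - v)%:P * monic_of_roots b1.
    by rewrite eqb /monic_of_roots big_cons polyCB; ring.
  have le_r k : normc (('X - c%:P) * (monic_of_roots a - monic_of_roots b1))`_k
      <= d + h' * L.
    rewrite eq_r coefD coefCM; apply: le_trans (normcD _ _) _.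
    apply: lerD (le_d k) _; rewrite normcM; apply: ler_pM; rewrite ?normc_ge0 //.
    by rewrite /L -sb1; apply: coef_monic_of_roots; rewrite ?(ltW M0).
  have sr : (size (monic_of_roots a - monic_of_roots b1)%R <= n.+1)%N.
    rewrite (leq_trans (size_polyD _ _)) // size_polyN !size_prod_XsubC sb1.
    by case: sca => ->; rewrite maxnn.
  move=> k; apply: le_trans (coef_XsubC_div M1 cM sr le_r k) _.
  have e1 : d * K <= d' / 2.
    rewrite -ler_pdivlMr // -mulrA -invfM /d ge_min lexx //.
  have e2 : h' * L * K <= d' / 2.
    rewrite -ler_pdivlMr // -ler_pdivlMr // -!mulrA -!invfM /h' ge_min.
    by rewrite mulrA lexx orbT.
  rewrite -/K mulrDl; lra.
exists (v :: b'); first by rewrite (perm_trans _ pb) // perm_cons.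
case=> [|i] lt_i /=; last exact: le_b'.
by apply: le_trans cv _; rewrite /h' ge_min lexx.
Qed.

(** Only the coefficients are required to depend continuously on the time; no
    continuous choice of the roots [F] is assumed.  Composing the matchings at
    the times [k / m] turns them into chains. *)
Lemma chained_matching n M K h (F : R -> seq C) (D : pred C) :
  0 < h -> 0 <= K ->
  (forall t, 0 <= t <= 1 -> size (F t) = n) ->
  (forall t c, 0 <= t <= 1 -> c \in F t -> normc c <= M) ->
  (forall t c, 0 <= t <= 1 -> c \in F t -> D c) ->
  (forall s t k, 0 <= s <= 1 -> 0 <= t <= 1 ->
     normc (monic_of_roots (F s) - monic_of_roots (F t))`_k <= K * `|s - t|) ->
  exists2 b, perm_eq b (F 1) &
    forall i, (i < n)%N -> chained h D (nth 0 (F 0) i) (nth 0 b i).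
Proof.
move=> h0 K0 sF FM FD lipF.
have [|d d0 Hd] := @match_close_roots n (Num.max 1 M) h _ h0.
  by rewrite le_max lexx.
have FM' t c : 0 <= t <= 1 -> c \in F t -> normc c <= Num.max 1 M.
  by move=> t01 /(FM t c t01) le; rewrite le_max le orbT.
(* With [m] steps the coefficients move by at most [K / m < d] in each step. *)
pose m := (Num.truncn (K / d)).+1.
have m_gt : K / d < m%:R by rewrite truncnS_gt.
have m0 : 0 < m%:R :> R by rewrite ltr0n.
have tm k : (k <= m)%N -> 0 <= (k%:R / m%:R : R) <= 1.
  by move=> km; rewrite divr_ge0 //= ler_pdivrMr // mul1r ler_nat.
suff H k : (k <= m)%N -> exists2 b, perm_eq b (F (k%:R / m%:R)) &
    forall i, (i < n)%N -> chained h D (nth 0 (F 0) i) (nth 0 b i).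
  by have := H m (leqnn m); rewrite divff // gt_eqF.
have z01 : 0 <= (0 : R) <= 1 by rewrite lexx ler01.
elim: k => [_|k IH lt_k].
  exists (F (0%:R / m%:R)) => // i lt_i; rewrite mul0r; apply: chained_refl.
  by apply: (FD 0) => //; rewrite mem_nth // sF.
have tk := tm k (ltnW lt_k); have tk1 := tm k.+1 lt_k.
have [b pb Hb] := IH (ltnW lt_k).
have sb : size b = n by rewrite (perm_size pb) sF.
have [||u|u|j|b' pb' Hb'] := Hd b (F (k.+1%:R / m%:R)).
- by [].
- by rewrite sF.
- by rewrite (perm_mem pb); apply: FM'.
- exact: FM'.
- have -> : monic_of_roots b = monic_of_roots (F (k%:R / m%:R)).
    exact: perm_big.
  apply: le_trans (lipF _ _ _ tk tk1) _.
  rewrite -mulrBl -natr1 opprD addNKr mulN1r normrN ger0_norm ?invr_ge0 ?ltW //.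
  by rewrite ltr_pdivrMr // mulrC -ltr_pdivrMr.
exists b' => // i lt_i.
apply: chained_rcons (Hb i lt_i) (Hb' i lt_i) _.
apply: (FD (k.+1%:R / m%:R)) => //.
by rewrite -(perm_mem pb') mem_nth // (perm_size pb') sF.
Qed.

End RootContinuity.

(** * Euclidean norms, operator bounds and determinants *)

Local Notation "M ^t*" := (map_mx Num.conj (trmx M)) (at level 30).

Section Euclidean.
Variable R : realType.
Local Notation C := R[i].

Lemma normc_sqrC (z : C) : (normc z ^+ 2)%:C%C = z * z^*.
Proof. by rewrite (rmorphXn (real_complex R)) /= -normCE normCK. Qed.

Lemma l2norm_ge0 n (x : 'cV[C]_n) : 0 <= l2norm x.
Proof. exact: sqrtr_ge0. Qed.

Lemma l2norm_sqr n (x : 'cV[C]_n) : l2norm x ^+ 2 = \sum_i normc (x i 0) ^+ 2.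
Proof. by rewrite sqr_sqrtr // sumr_ge0 // => i _; rewrite exprn_ge0 ?normc_ge0. Qed.

Lemma l2norm_sqrC n (x : 'cV[C]_n) : (l2norm x ^+ 2)%:C%C = (x ^t* *m x) 0 0.
Proof.
rewrite l2norm_sqr rmorph_sum mxE; apply: eq_bigr => i _ /=.
by rewrite rmorphXn /= -normCE normCK !mxE mulrC.
Qed.

Lemma l2norm_eq0 n (x : 'cV[C]_n) : (l2norm x == 0) = (x == 0).
Proof.
apply/eqP/eqP => [x0|->]; last first.
  by rewrite /l2norm big1 ?sqrtr0 // => i _; rewrite mxE normc0 expr0n.
apply/matrixP => i j; rewrite mxE ord1; apply/eqP; rewrite -normc_eq0 -sqrf_eq0.
move: (l2norm_sqr x); rewrite x0 expr0n /= => /esym/eqP.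
rewrite psumr_eq0 => [/allP/(_ i)|k _]; last by rewrite exprn_ge0 ?normc_ge0.
by rewrite mem_index_enum => /(_ isT).
Qed.

Lemma l2norm0 n : l2norm (0 : 'cV[C]_n) = 0.
Proof. by apply/eqP; rewrite l2norm_eq0. Qed.

Lemma l2norm_gt0 n (x : 'cV[C]_n) : (0 < l2norm x) = (x != 0).
Proof. by rewrite lt_def l2norm_eq0 l2norm_ge0 andbT. Qed.

Lemma l2normZ n a (x : 'cV[C]_n) : l2norm (a *: x) = normc a * l2norm x.
Proof.
apply/eqP; rewrite -(@eqrXn2 _ 2) ?mulr_ge0 ?l2norm_ge0 ?normc_ge0 //.
rewrite exprMn !l2norm_sqr mulr_sumr; apply/eqP; apply: eq_bigr => i _.
by rewrite mxE normcM exprMn.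
Qed.

(** Termwise arithmetic-geometric mean inequality, with weights that make the
    two halves of the bound equal. *)
Lemma cauchy_schwarz_sum (I : finType) (a b : I -> R) (A B : R) :
  0 < A -> 0 < B -> \sum_i a i ^+ 2 = A ^+ 2 -> \sum_i b i ^+ 2 = B ^+ 2 ->
  \sum_i a i * b i <= A * B.
Proof.
move=> A0 B0 eA eB.
have -> : A * B = \sum_i (a i ^+ 2 * (B / (2 * A)) + b i ^+ 2 * (A / (2 * B))).
  rewrite big_split /= -!mulr_suml eA eB; field.
  by rewrite !gt_eqF.
apply: ler_sum => i _; rewrite -subr_ge0.
have -> : a i ^+ 2 * (B / (2 * A)) + b i ^+ 2 * (A / (2 * B)) - a i * b i =
  (a i * B - b i * A) ^+ 2 / (2 * A * B).
  by field; rewrite !gt_eqF.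
by rewrite divr_ge0 ?sqr_ge0 // !mulr_ge0 // ltW.
Qed.

Lemma l2normD n (x y : 'cV[C]_n) : l2norm (x + y) <= l2norm x + l2norm y.
Proof.
have [->|x0] := eqVneq x 0; first by rewrite l2norm0 !add0r.
have [->|y0] := eqVneq y 0; first by rewrite l2norm0 !addr0.
rewrite -(@ler_pXn2r _ 2) ?nnegrE ?addr_ge0 ?l2norm_ge0 //.
apply: le_trans (_ : \sum_i (normc (x i 0) + normc (y i 0)) ^+ 2 <= _).
  rewrite l2norm_sqr; apply: ler_sum => i _; rewrite mxE lerXn2r ?normcD //.
    by rewrite nnegrE normc_ge0.
  by rewrite nnegrE addr_ge0 ?normc_ge0.
rewrite sqrrD !l2norm_sqr; under eq_bigr do rewrite sqrrD.
rewrite !big_split /= lerD2r lerD2l -mulr2n lerMn2r /=.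
by apply: cauchy_schwarz_sum; rewrite ?l2norm_gt0 // l2norm_sqr.
Qed.

Lemma l2norm_sum n (I : finType) (F : I -> 'cV[C]_n) :
  l2norm (\sum_i F i) <= \sum_i l2norm (F i).
Proof.
elim/big_rec2: _ => [|i u v _ le_uv]; first by rewrite l2norm0.
by apply: le_trans (l2normD _ _) _; rewrite lerD2l.
Qed.

Lemma normc_entry_le n (x : 'cV[C]_n) i : normc (x i 0) <= l2norm x.
Proof.
rewrite -(@ler_pXn2r _ 2) ?nnegrE ?l2norm_ge0 ?normc_ge0 //.
rewrite l2norm_sqr (bigD1 i) //= lerDl sumr_ge0 // => j _.
by rewrite exprn_ge0 ?normc_ge0.
Qed.

Lemma l2norm_col_mx m n (x : 'cV[C]_m) (y : 'cV[C]_n) :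
  l2norm (col_mx x y) ^+ 2 = l2norm x ^+ 2 + l2norm y ^+ 2.
Proof.
rewrite !l2norm_sqr big_split_ord /=; congr (_ + _); apply: eq_bigr => i _.
  by rewrite col_mxEu.
by rewrite col_mxEd.
Qed.

Lemma l2norm_col_mxu m n (x : 'cV[C]_m) (y : 'cV[C]_n) :
  l2norm x <= l2norm (col_mx x y).
Proof.
rewrite -(@ler_pXn2r _ 2) ?nnegrE ?l2norm_ge0 // l2norm_col_mx.
by rewrite lerDl exprn_ge0 ?l2norm_ge0.
Qed.

Lemma l2norm_col_mxd m n (x : 'cV[C]_m) (y : 'cV[C]_n) :
  l2norm y <= l2norm (col_mx x y).
Proof.
rewrite -(@ler_pXn2r _ 2) ?nnegrE ?l2norm_ge0 // l2norm_col_mx.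
by rewrite lerDr exprn_ge0 ?l2norm_ge0.
Qed.

Lemma l2norm_col_mx_le m n (x : 'cV[C]_m) (y : 'cV[C]_n) :
  l2norm (col_mx x y) <= l2norm x + l2norm y.
Proof.
rewrite -(@ler_pXn2r _ 2) ?nnegrE ?addr_ge0 ?l2norm_ge0 // l2norm_col_mx.
by rewrite sqrrD -addrA lerD2l lerDr mulrn_wge0 // mulr_ge0 ?l2norm_ge0.
Qed.

(** Operator norms are handled through their upper bounds: for block matrices,
    bounds are all that is needed and suprema need not be evaluated. *)
Definition mx_bound m n (A : 'M[C]_(m, n)) (c : R) :=
  forall v, l2norm (A *m v) <= c * l2norm v.

Lemma mx_boundD m n (A B : 'M[C]_(m, n)) a b :
  mx_bound A a -> mx_bound B b -> mx_bound (A + B) (a + b).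
Proof.
move=> Aa Bb v; rewrite mulmxDl mulrDl.
by apply: le_trans (l2normD _ _) _; exact: lerD.
Qed.

Lemma mx_boundZ m n (A : 'M[C]_(m, n)) a z :
  mx_bound A a -> mx_bound (z *: A) (normc z * a).
Proof.
by move=> Aa v; rewrite -scalemxAl l2normZ -mulrA ler_wpM2l ?normc_ge0.
Qed.

Lemma mx_boundM m n p (A : 'M[C]_(m, n)) (B : 'M[C]_(n, p)) a b : 0 <= a ->
  mx_bound A a -> mx_bound B b -> mx_bound (A *m B) (a * b).
Proof.
move=> a0 Aa Bb v; rewrite -mulmxA -mulrA; apply: le_trans (Aa _) _.
by rewrite ler_wpM2l.
Qed.

Lemma mx_bound_scalar n z : mx_bound (z%:M : 'M[C]_n) (normc z).
Proof. by move=> v; rewrite mul_scalar_mx l2normZ. Qed.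

Lemma mx_bound_ge0 m n (A : 'M[C]_(m, n)) c : (0 < n)%N -> mx_bound A c -> 0 <= c.
Proof.
case: n A => // n A _ Ac; pose e : 'cV[C]_n.+1 := const_mx 1.
have e0 : 0 < l2norm e.
  by rewrite l2norm_gt0; apply/eqP => /matrixP/(_ 0 0)/eqP; rewrite !mxE oner_eq0.
by rewrite -(pmulr_lge0 _ e0); apply: le_trans (Ac e); exact: l2norm_ge0.
Qed.

Lemma mx_bound_exists m n (A : 'M[C]_(m, n)) : exists c, mx_bound A c.
Proof.
exists (\sum_j l2norm (col j A)) => v.
have -> : A *m v = \sum_j v j 0 *: col j A.
  apply/colP => i; rewrite summxE mxE; apply: eq_bigr => j _.
  by rewrite !mxE mulrC.
apply: le_trans (l2norm_sum _) _; rewrite mulr_suml; apply: ler_sum => j _.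
by rewrite l2normZ mulrC ler_wpM2l ?l2norm_ge0 // normc_entry_le.
Qed.

Lemma spectral_norm_bound n (A : 'M[C]_n) : mx_bound A (spectral_norm A).
Proof.
move=> v; have [->|v0] := eqVneq v 0; first by rewrite mulmx0 l2norm0 mulr0.
have nv : 0 < l2norm v by rewrite l2norm_gt0.
have [c Ac] := mx_bound_exists A.
rewrite -ler_pdivrMr //; apply: ub_le_sup.
  exists `|c| => _ [x /= x1 <-]; apply: le_trans (Ac x) _.
  apply: le_trans (_ : `|c| * l2norm x <= _).
    by rewrite ler_wpM2r ?l2norm_ge0 // ler_norm.
  by rewrite ler_piMr.
have iv : `|(l2norm v)^-1| = (l2norm v)^-1 by rewrite ger0_norm ?invr_ge0 ?ltW.
exists ((l2norm v)^-1%:C%C *: v) => /=.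
  by rewrite l2normZ normc_real iv mulVf ?gt_eqF.
by rewrite -scalemxAr l2normZ normc_real iv mulrC.
Qed.

Lemma spectral_norm_gt0 n (A : 'M[C]_n) : A != 0 -> 0 < spectral_norm A.
Proof.
move=> A0; have [j Aj] : exists j, col j A != 0.
  apply/existsP; apply: contraNT A0; rewrite negb_exists => /forallP H.
  apply/eqP/matrixP => i j; have /negPn/eqP/colP/(_ i) := H j.
  by rewrite !mxE.
have := spectral_norm_bound A (delta_mx j 0); rewrite -colE.
rewrite -l2norm_gt0 in Aj => /(lt_le_trans Aj).
by rewrite pmulr_lgt0 // l2norm_gt0; apply/eqP => /matrixP/(_ j 0)/eqP;
  rewrite !mxE !eqxx oner_eq0.
Qed.

Lemma spectral_norm_ge0 n (A : 'M[C]_n) : (0 < n)%N -> 0 <= spectral_norm A.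
Proof. by move=> n0; apply: mx_bound_ge0 n0 (@spectral_norm_bound n A). Qed.

Lemma unitmx_neq0 n (A : 'M[C]_n) : (0 < n)%N -> A \in unitmx -> A != 0.
Proof.
move=> n0; apply: contraTneq => ->; rewrite unitmxE unitfE.
by case: n n0 {A} => // n _; rewrite det0 eqxx.
Qed.

Lemma trmxC_mul m n p (A : 'M[C]_(m, n)) (B : 'M[C]_(n, p)) :
  (A *m B) ^t* = B ^t* *m A ^t*.
Proof. by rewrite trmx_mul map_mxM. Qed.

(** Diagonalize the Gram matrix of [M].  Its eigenvalues [r_i] are the squares of
    the singular values: they are at most [m^2], their product is
    [|\det M|^2], and the least of them bounds [|M v|^2 / |v|^2] from below. *)
Lemma det_le_mx_bound n (M : 'M[C]_n) (m : R) (v : 'cV[C]_n) :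
  (0 < n)%N -> mx_bound M m ->
  normc (\det M) * l2norm v <= l2norm (M *m v) * m ^+ n.-1.
Proof.
case: n M v => // n M v _ Mm.
have m0 : 0 <= m by apply: mx_bound_ge0 Mm.
pose H := M ^t* *m M; pose P := spectralmx H; pose W := M *m P ^t*.
have PP : P *m P ^t* = 1%:M by apply/unitarymxP; exact: spectral_unitarymx.
have P'P : P ^t* *m P = 1%:M by apply: mulmx1C.
have HH : H ^t* = H by rewrite /H trmxC_mul trmxCK.
have Hn : H \is normalmx by apply/normalmxP; rewrite HH.
pose r i := l2norm (col i W) ^+ 2.
have WW : W ^t* *m W = diag_mx (\row_i (r i)%:C%C).
  have /orthomx_spectralP : H \is normalmx by [].
  rewrite -/P invmx_unitary ?spectral_unitarymx //.
  move: (spectral_diag H) => D eqH.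
  have eqW : W ^t* *m W = diag_mx D.
    rewrite /W trmxC_mul trmxCK -mulmxA [_ *m (M *m _)]mulmxA -/H eqH.
    by rewrite !mulmxA PP mul1mx -mulmxA PP mulmx1.
  rewrite eqW; congr diag_mx; apply/rowP => i; rewrite mxE /r l2norm_sqrC.
  have -> : ((col i W) ^t* *m col i W) 0 0 = (W ^t* *m W) i i.
    by rewrite !mxE; apply: eq_bigr => j _; rewrite !mxE.
  by rewrite eqW mxE eqxx mulr1n.
have col_P i : l2norm (col i (P ^t*)) = 1.
  apply/eqP; rewrite -(@eqrXn2 _ 2) ?l2norm_ge0 // expr1n.
  apply/eqP/complexI; rewrite l2norm_sqrC.
  have -> : ((col i (P ^t*)) ^t* *m col i (P ^t*)) 0 0 = (P *m P ^t*) i i.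
    by rewrite !mxE; apply: eq_bigr => j _; rewrite !mxE conjCK.
  by rewrite PP mxE eqxx.
have r_ge0 i : 0 <= r i by rewrite exprn_ge0 ?l2norm_ge0.
have r_le i : r i <= m ^+ 2.
  rewrite lerXn2r ?nnegrE ?l2norm_ge0 //.
  have -> : col i W = M *m col i (P ^t*) by rewrite !colE mulmxA.
  by apply: le_trans (Mm _) _; rewrite col_P mulr1.
have [i0 _ r_min] := @arg_minP _ _ _ (@ord0 n) xpredT r isT.
have detM : normc (\det M) ^+ 2 = \prod_i r i.
  apply: complexI; rewrite rmorphXn rmorph_prod /= -normCE normCK.
  have -> : \prod_i (r i)%:C%C = \det (W ^t* *m W).
    by rewrite WW det_diag; apply: eq_bigr => i _; rewrite mxE.
  have PP1 : \det P * \det (P ^t*) = 1 by rewrite -det_mulmx PP det1.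
  have MM : \det (M ^t*) = (\det M)^* by rewrite det_map_mx det_tr.
  rewrite /W trmxC_mul trmxCK !det_mulmx MM -[LHS]mul1r -[X in X * _ = _]PP1.
  by ring.
have Mv : r i0 * l2norm v ^+ 2 <= l2norm (M *m v) ^+ 2.
  pose y := P *m v.
  have eqy : l2norm v ^+ 2 = l2norm y ^+ 2.
    apply: complexI; rewrite !l2norm_sqrC /y trmxC_mul -mulmxA.
    by rewrite [P ^t* *m (P *m v)]mulmxA P'P mul1mx.
  have -> : l2norm (M *m v) ^+ 2 = \sum_i r i * normc (y i 0) ^+ 2.
    apply: complexI; rewrite l2norm_sqrC.
    have -> : M *m v = W *m y by rewrite /W /y -mulmxA [P ^t* *m _]mulmxA P'P mul1mx.
    rewrite trmxC_mul -mulmxA [_ *m (W *m y)]mulmxA WW mul_diag_mx mxE rmorph_sum.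
    apply: eq_bigr => i _; rewrite !mxE; move: (\sum_j _) => z.
    rewrite [RHS](rmorphM (real_complex R)) /= normc_sqrC.
    by rewrite mulrCA [_^* * _]mulrC.
  rewrite eqy l2norm_sqr mulr_sumr; apply: ler_sum => i _.
  by rewrite ler_wpM2r ?exprn_ge0 ?normc_ge0 // r_min.
rewrite -(@ler_pXn2r _ 2) ?nnegrE ?mulr_ge0 ?normc_ge0 ?l2norm_ge0 ?exprn_ge0 //.
rewrite !exprMn detM (bigD1 i0) //= mulrAC.
apply: ler_pM => //; first by rewrite mulr_ge0 ?exprn_ge0 ?l2norm_ge0.
  by rewrite prodr_ge0.
apply: le_trans (_ : \prod_(i < n.+1 | i != i0) m ^+ 2 <= _).
  by apply: ler_prod => i _; rewrite r_ge0 r_le.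
by rewrite prodr_const cardC1 card_ord /= -!exprM mulnC.
Qed.

End Euclidean.

(** * Matching the eigenvalues of two matrices *)

Section Matching.
Variable R : realType.
Local Notation C := R[i].

Lemma poly_lipschitz (p : {poly C}) : exists2 K : R, 0 <= K &
  forall s t, normc s <= 1 -> normc t <= 1 ->
    normc (p.[s] - p.[t]) <= K * normc (s - t).
Proof.
elim/poly_ind: p => [|p c [K K0 lipK]].
  by exists 0 => // s t _ _; rewrite !horner0 subrr normc0 mul0r.
have z1 : normc (0 : C) <= 1 by rewrite normc0.
exists (K + (normc p.[0] + K)); first by rewrite !addr_ge0 ?normc_ge0.
move=> s t s1 t1; rewrite !hornerD !hornerM !hornerX !hornerC.
have -> : p.[s] * s + c - (p.[t] * t + c) = (p.[s] - p.[t]) * s + p.[t] * (s - t).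
  by ring.
apply: le_trans (normcD _ _) _; rewrite !normcM mulrDl; apply: lerD.
  rewrite -[X in _ <= X]mulr1; apply: ler_pM; rewrite ?normc_ge0 //.
  exact: lipK.
rewrite ler_wpM2r ?normc_ge0 //.
rewrite -(subrK p.[0] p.[t]) addrC; apply: le_trans (normcD _ _) _; rewrite lerD2l.
apply: le_trans (lipK _ _ t1 z1) _.
by rewrite subr0 ler_piMr.
Qed.

(** The coefficients of the characteristic polynomial of [A + z E] are
    polynomials in [z]: they come from a characteristic polynomial over
    [{poly {poly C}}]. *)
Lemma char_poly_lipschitz n (A E : 'M[C]_n) : exists2 K : R, 0 <= K &
  forall s t k, normc s <= 1 -> normc t <= 1 ->
    normc (char_poly (A + s *: E) - char_poly (A + t *: E))`_k <= K * normc (s - t).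
Proof.
pose G := char_poly (map_mx polyC A + 'X *: map_mx polyC E).
have coefG z k : (char_poly (A + z *: E))`_k = (G`_k).[z].
  have -> : A + z *: E =
      map_mx (horner_eval z) (map_mx polyC A + 'X *: map_mx polyC E).
    apply/matrixP => i j; rewrite !mxE /horner_eval /= hornerD hornerM hornerX.
    by rewrite !hornerC.
  by rewrite -map_char_poly coef_map.
have [K K0 lipK] : exists2 K : R, 0 <= K & forall s t k, (k < size G)%N ->
    normc s <= 1 -> normc t <= 1 ->
    normc ((G`_k).[s] - (G`_k).[t]) <= K * normc (s - t).
  elim: (size G) => [|m [K K0 IH]]; first by exists 0.
  have [K' K'0 lipK'] := poly_lipschitz (G`_m).
  exists (K + K'); first by rewrite addr_ge0.
  move=> s t k; rewrite ltnS leq_eqVlt mulrDl => /orP[/eqP -> s1 t1|km s1 t1].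
    by rewrite -[X in X <= _]add0r lerD ?mulr_ge0 ?normc_ge0 ?lipK'.
  by rewrite -[X in X <= _]addr0 lerD ?mulr_ge0 ?normc_ge0 ?IH.
exists K => // s t k s1 t1; have := coefG t k; have := coefG s k.
move: (char_poly (A + s *: E)) (char_poly (A + t *: E)) => ps pt es et.
rewrite coefB es et.
have [km|km] := ltnP k (size G); first exact: lipK.
by rewrite nth_default // !horner0 subrr normc0 mulr_ge0 ?normc_ge0.
Qed.

(** A property that gets stronger as [h] decreases and that some element of a
    finite list has for each [h] is shared for all [h] by one element. *)
Lemma finite_limit_choice (T : eqType) (l : seq T) (Q : R -> T -> Prop) :
  (forall h h' x, h <= h' -> Q h x -> Q h' x) ->
  (forall h, 0 < h -> exists2 x, x \in l & Q h x) ->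
  exists2 x, x \in l & forall h, 0 < h -> Q h x.
Proof.
move=> Qmono; elim: l => [|x l IH] H; first by have [] := H 1 ltr01.
have [?|] := pselect (forall h, 0 < h -> Q h x); first by exists x; rewrite ?mem_head.
move=> /existsNP[h0 /not_implyP[h0_gt0 nQ]].
have [|y yl Qy] := IH; last by exists y => //; rewrite inE yl orbT.
move=> h h_gt0; have m0 : 0 < Num.min h h0 by rewrite lt_min h_gt0.
have [y + Qy] := H _ m0; rewrite inE => /orP[/eqP yx|yl].
  by case: nQ; rewrite -yx; apply: Qmono Qy; rewrite ge_min lexx orbT.
by exists y => //; apply: Qmono Qy; rewrite ge_min lexx.
Qed.

Lemma horner_char_poly n (A : 'M[C]_n) z : (char_poly A).[z] = \det (z%:M - A).
Proof.
rewrite /char_poly -[LHS]/(horner_eval z _) -det_map_mx; congr (\det _).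
apply/matrixP => i j; rewrite !mxE -[LHS]/(horner _ z) hornerD hornerN hornerC.
by rewrite hornerMn hornerX.
Qed.

Lemma eigenvector_char_poly n (A : 'M[C]_n) z : root (char_poly A) z ->
  exists2 v : 'cV[C]_n, v != 0 & A *m v = z *: v.
Proof.
rewrite rootE horner_char_poly -det_tr => /det0P[u u0 uA].
exists u^T; first by rewrite trmx_eq0.
apply/eqP; rewrite eq_sym -subr_eq0 -mul_scalar_mx -mulmxBl.
by rewrite -[_ - _]trmxK -trmx_mul uA trmx0.
Qed.

(** The theorem of Bhatia, Elsner and Krause.  The hypothesis [a <= b] ensures
    that [b] bounds the whole segment from [A] to [B]; this is why [a + b], and
    not twice the larger bound, appears in the conclusion. *)
Lemma eigenvalue_matching n (A B : 'M[C]_n) (a b eps : R) (s t : seq C) :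
  (0 < n)%N -> a <= b ->
  mx_bound A a -> mx_bound B b -> mx_bound (B - A) eps ->
  char_poly A = monic_of_roots s -> char_poly B = monic_of_roots t ->
  exists2 t', perm_eq t' t & forall i, (i < n)%N ->
    2 * (normc (nth 0 t' i - nth 0 s i) / 4) ^+ n <= eps * (a + b) ^+ n.-1.
Proof.
move=> n_gt0 ab Aa Bb Eeps charA charB; set r := eps * _.
have a0 := mx_bound_ge0 n_gt0 Aa; have b0 := mx_bound_ge0 n_gt0 Bb.
have eps0 := mx_bound_ge0 n_gt0 Eeps.
pose P (x : R) := A + x%:C%C *: (B - A).
have [F [F0 FP]] : exists F : R -> seq C,
    F 0 = s /\ forall x, char_poly (P x) = monic_of_roots (F x).
  exists (fun x => if x == 0 then s else
                   sval (closed_field_poly_normal (char_poly (P x)))).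
  rewrite eqxx; split=> // x; case: eqP => [->|_]; first by rewrite /P scale0r addr0.
  case: closed_field_poly_normal => l /= eql; rewrite {1}eql.
  by rewrite (monicP (char_poly_monic _)) scale1r.
have sF x : size (F x) = n.
  have := congr1 (size : {poly C} -> nat) (FP x).
  by rewrite size_char_poly size_prod_XsubC => -[].
have P_bound x : 0 <= x <= 1 -> forall v, l2norm (P x *m v) <= b * l2norm v.
  move=> /andP[x0 x1] v.
  have -> : P x = (1 - x)%:C%C *: A + x%:C%C *: B.
    by rewrite /P rmorphB scalerBl scale1r scalerBr addrA addrAC.
  apply: le_trans (mx_boundD (mx_boundZ _ Aa) (mx_boundZ _ Bb) v) _.
  rewrite !normc_real !ger0_norm ?subr_ge0 // ler_wpM2r ?l2norm_ge0 //.
  nra.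
have eigF x c : 0 <= x <= 1 -> c \in F x ->
    exists2 v : 'cV[C]_n, v != 0 & P x *m v = c *: v.
  move=> x01 cF; apply: eigenvector_char_poly.
  by rewrite FP root_prod_XsubC.
have FM x c : 0 <= x <= 1 -> c \in F x -> normc c <= b.
  move=> x01 /(eigF x c x01)[v v0 Pv]; have := P_bound x x01 v.
  by rewrite Pv l2normZ ler_pM2r // l2norm_gt0.
have FD x c : 0 <= x <= 1 -> c \in F x ->
    (normc c <= b) && (normc (\prod_(u <- s) (c - u)) <= r).
  move=> x01 cF; have cb := FM x c x01 cF; rewrite cb /=.
  have [v v0 Pv] := eigF x c x01 cF; rewrite -l2norm_gt0 in v0.
  have -> : \prod_(u <- s) (c - u) = \det (c%:M - A).
    rewrite -horner_char_poly charA horner_prod; apply: eq_bigr => u _.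
    by rewrite hornerXsubC.
  have bnd : mx_bound (c%:M - A) (a + b).
    move=> w; apply: le_trans (_ : (normc c + normc (-1 : C) * a) * l2norm w <= _).
      by rewrite -scaleN1r; apply: mx_boundD;
        [exact: mx_bound_scalar|exact: mx_boundZ].
    by rewrite normc_opp normc1 mul1r ler_wpM2r ?l2norm_ge0 // addrC lerD2l.
  have := det_le_mx_bound v n_gt0 bnd.
  have -> : (c%:M - A) *m v = x%:C%C *: ((B - A) *m v).
    by rewrite mulmxBl mul_scalar_mx -Pv /P mulmxDl addrAC subrr add0r scalemxAl.
  rewrite l2normZ normc_real; have /andP[x0 x1] := x01; rewrite ger0_norm // => le1.
  rewrite -(ler_pM2r v0); apply: le_trans le1 _.
  rewrite /r [X in _ <= X]mulrAC ler_wpM2r ?exprn_ge0 ?addr_ge0 //.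
  apply: le_trans (_ : 1 * l2norm ((B - A) *m v) <= _).
    by rewrite ler_wpM2r ?l2norm_ge0.
  by rewrite mul1r.
have [K K0 lipK] := char_poly_lipschitz A (B - A).
pose K' := n%:R * (2 * b + 1) ^+ n.
have K'0 : 0 <= K' by rewrite mulr_ge0 ?exprn_ge0 ?addr_ge0 ?mulr_ge0.
have [||t' t't le_t'] := @finite_limit_choice _ (permutations t)
  (fun h t' => forall i, (i < n)%N ->
    2 * (normc (nth 0 t' i - nth 0 s i) / 4) ^+ n <= r + h * K').
- move=> h h' l hh' H i lt_i; apply: le_trans (H i lt_i) _.
  by rewrite lerD2l ler_wpM2r.
- move=> h h0; pose h1 := Num.min h 1.
  have h1_0 : 0 < h1 by rewrite lt_min h0 ltr01.
  have h1_1 : 0 <= h1 <= 1 by rewrite ltW //= ge_min lexx orbT.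
  have [x y k x01 y01|t' t'F le_t'] :=
    chained_matching (K := K) h1_0 K0 (fun x _ => sF x) FM FD.
    have /andP[x0 x1] := x01; have /andP[y0 y1] := y01.
    rewrite -(FP x) -(FP y) -normc_real (rmorphB (real_complex R)).
    by apply: lipK; rewrite normc_real ger0_norm.
  exists t'.
    rewrite mem_permutations (perm_trans t'F) //; apply: prod_XsubC_eq.
    rewrite -[LHS]/(monic_of_roots (F 1)) -[RHS]/(monic_of_roots t) -FP -charB.
    by rewrite /P scale1r addrC subrK.
  move=> i lt_i; have := le_t' i lt_i; rewrite F0 => ch.
  have ss : size s = n by rewrite -F0 sF.
  have := chained_dist_le _ h1_1 _ ch; rewrite ss => /(_ n_gt0).
  move=> H; apply: le_trans (H _) _.
    by move=> c cs; apply: (FM 0); rewrite ?lexx ?ler01 // F0.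
  by rewrite lerD2l ler_wpM2r // ge_min lexx.
exists t'; first by rewrite -mem_permutations.
move=> i lt_i; apply/ler_addgt0Pr => e e0.
have K1 : 0 < K' + 1 by rewrite ltr_wpDl.
apply: le_trans (le_t' (e / (K' + 1)) _ i lt_i) _; first by rewrite divr_gt0.
by rewrite lerD2l mulrAC ler_pdivrMr // ler_pM2l // lerDl.
Qed.

End Matching.

(** * Companion matrices and spectra *)

Section Companion.
Variable R : realType.
Local Notation C := R[i].

(** One block column operation makes the upper left block the identity, and
    one block row operation then clears the block below it. *)
Lemma det_block_quadratic (K : comNzRingType) n (x a b : K) (U V : 'M[K]_n) :
  a * b = 1 ->
  \det (block_mx x%:M (- a%:M) (b *: V) (x%:M + U)) =
  \det ((x ^+ 2)%:M + x *: U + V).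
Proof.
move=> ab1; set B := block_mx _ _ _ _.
(* [b * (x - 1)] is the multiple for which the upper left block becomes
   [x - a * (b * (x - 1)) = 1]. *)
pose W := b *: V + (b * (x - 1)) *: (x%:M + U).
pose T : 'M[K]_(n + n) := block_mx 1%:M 0 (b * (x - 1))%:M 1%:M.
pose L : 'M[K]_(n + n) := block_mx 1%:M 0 (- W) 1%:M.
have -> : \det B = \det (L *m B *m T).
  by rewrite !det_mulmx !det_lblock !det1 !mulr1 mul1r.
have -> : L *m B *m T = block_mx 1%:M (- a%:M) 0 ((x ^+ 2)%:M + x *: U + V).
  rewrite -mulmxA /B /T mulmx_block !mulmx1 !mulmx0 !add0r.
  have -> : x%:M + - a%:M *m (b * (x - 1))%:M = 1%:M :> 'M[K]_n.
    rewrite mulNmx -scalar_mxM mulrA ab1 mul1r -raddfB /=.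
    by rewrite opprB addrC subrK.
  have -> : b *: V + (x%:M + U) *m (b * (x - 1))%:M = W.
    by rewrite mul_mx_scalar.
  rewrite /L mulmx_block !mul1mx !mul0mx !addr0 mulmx1 addNr.
  congr (block_mx _ _ _ _); rewrite mulNmx mulmxN opprK mul_mx_scalar /W.
  rewrite scalerDr !scalerA mulrA ab1 mul1r scale1r -addrA -[X in _ + (_ + X)]scale1r.
  rewrite -scalerDl subrK scalerDr scale_scalar_mx -expr2.
  by rewrite addrC.
by rewrite det_ublock det1 mul1r.
Qed.

(** For every nonzero [al] this is similar to the usual companion matrix of the
    monic quadratic polynomial, so [al] can be chosen to balance the norms of
    the two rows of blocks. *)
Definition companion n (al : C) (U V : 'M[C]_n) : 'M[C]_(n + n) :=
  block_mx 0 al%:M (- (al^-1 *: V)) (- U).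

Lemma char_poly_companion n (al : C) (U V : 'M[C]_n) : al != 0 ->
  char_poly (companion al U V) = \det (quad_poly 1%:M U V).
Proof.
move=> al0; rewrite /char_poly /char_poly_mx /quad_poly /companion.
rewrite map_block_mx scalar_mx_block opp_block_mx add_block_mx.
rewrite !map_mxN !map_mx0 !opprK !oppr0 !addr0 !add0r map_scalar_mx map_mxZ /=.
rewrite (@det_block_quadratic _ _ 'X al%:P (al^-1)%:P); last first.
  by rewrite -polyCM divff.
by rewrite map_mx1 -scalemx1.
Qed.

Lemma det_quad_poly n (A2 A1 A0 : 'M[C]_n) : A2 \in unitmx ->
  \det (quad_poly A2 A1 A0) =
  (\det A2)%:P * \det (quad_poly 1%:M (invmx A2 *m A1) (invmx A2 *m A0)).
Proof.
move=> A2u; rewrite -det_map_mx -det_mulmx; congr (\det _).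
rewrite /quad_poly !mulmxDr -!scalemxAr map_mx1 mulmx1 -!map_mxM.
by rewrite !mulKVmx.
Qed.

Lemma det_lin_pencil n (A2 A1 : 'M[C]_n) : A2 \in unitmx ->
  \det (lin_pencil A2 A1) = (\det A2)%:P * char_poly (- (invmx A2 *m A1)).
Proof.
move=> A2u; rewrite /char_poly -det_map_mx -det_mulmx; congr (\det _).
rewrite /lin_pencil /char_poly_mx map_mxN opprK mulmxDr -map_mxM mulKVmx //.
by rewrite mul_mx_scalar.
Qed.

Lemma char_poly_companion0 n (al : C) (U : 'M[C]_n) : al != 0 ->
  char_poly (companion al U 0) = 'X^n * char_poly (- U).
Proof.
move=> al0; rewrite char_poly_companion // /char_poly /char_poly_mx -detZ.
congr (\det _); rewrite /quad_poly map_mx0 addr0 map_mx1 map_mxN opprK scalerDr.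
by rewrite !scale_scalar_mx mulr1 expr2.
Qed.

Lemma is_spec_monic_of_roots n (P : 'M[{poly C}]_n) (c : C) (q : {poly C})
    m (s : m.-tuple C) :
  c != 0 -> q \is monic -> \det P = c%:P * q -> is_spec P s ->
  q = monic_of_roots s.
Proof.
move=> c0 q_monic detP spec; have [r Dr] := closed_field_poly_normal q.
rewrite (monicP q_monic) scale1r in Dr; rewrite Dr; apply: perm_big.
apply/allP => z _ /=; apply/eqP; rewrite spec detP mupMr ?Dr ?mu_prod_XsubC //.
by rewrite rootC.
Qed.

Lemma mx_bound_companion n (al u w : R) (U V : 'M[C]_n) : 0 < al -> 
  mx_bound U u -> mx_bound V w -> 0 <= u -> 0 <= w ->
  mx_bound (companion al%:C%C U V) (al + u + w / al).
Proof.
move=> al0 Uu Vw u0 w0 v; rewrite -[v]vsubmxK; set x := usubmx v; set y := dsubmx v.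
rewrite /companion mul_block_col mul0mx add0r mul_scalar_mx !mulNmx -scalemxAl.
apply: le_trans (l2norm_col_mx_le _ _) _; rewrite -fmorphV.
have nN (z : 'cV[C]_n) : l2norm (- z) = l2norm z.
  by rewrite -scaleN1r l2normZ normc_opp normc1 mul1r.
have e1 := l2normD (- ((al^-1)%:C%C *: (V *m x))) (- (U *m y)).
rewrite !nN l2normZ normc_real ger0_norm ?invr_ge0 ?(ltW al0) // in e1.
rewrite l2normZ normc_real gtr0_norm //.
have hx := l2norm_col_mxu x y; have hy := l2norm_col_mxd x y.
have e2 : al * l2norm y <= al * l2norm (col_mx x y) by rewrite ler_pM2l.
have e3 : l2norm (U *m y) <= u * l2norm (col_mx x y).
  by apply: le_trans (Uu y) _; rewrite ler_wpM2l.
have e4 : al^-1 * l2norm (V *m x) <= w / al * l2norm (col_mx x y).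
  rewrite mulrAC mulrC ler_wpM2r ?invr_ge0 ?(ltW al0) //.
  by apply: le_trans (Vw x) _; rewrite ler_wpM2l.
rewrite !mulrDl; lra.
Qed.

Lemma mx_bound_companionB n (al w : R) (U V : 'M[C]_n) : 0 < al ->
  mx_bound V w -> 0 <= w ->
  mx_bound (companion al%:C%C U V - companion al%:C%C U 0) (w / al).
Proof.
move=> al0 Vw w0 v; rewrite -[v]vsubmxK; set x := usubmx v; set y := dsubmx v.
rewrite /companion opp_block_mx add_block_mx !subrr scaler0 oppr0 subr0.
rewrite mul_block_col !mul0mx !addr0 mulNmx -scalemxAl -fmorphV -scaleNr.
apply: le_trans (l2norm_col_mx_le _ _) _; rewrite l2norm0 add0r.
rewrite l2normZ normc_opp normc_real ger0_norm ?invr_ge0 ?(ltW al0) //.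
rewrite mulrAC mulrC ler_wpM2r ?invr_ge0 ?(ltW al0) //.
by apply: le_trans (Vw x) _; rewrite ler_wpM2l // l2norm_col_mxu.
Qed.

End Companion.

Section Assembly.
Variable R : realType.
Local Notation C := R[i].

(** If [c1^2 <= c0 c2], the middle monomial is at most the geometric mean of the
    other two.  A maximum attained twice is then attained by both of these, and
    [c0 = c2 z^2] leaves a single tropical root. *)
Lemma tropical_roots_distinct (c0 c1 c2 : R) :
  0 <= c0 -> 0 <= c1 -> 0 < c2 ->
  (exists x y : R, [/\ x != y, tropical_root [tuple c0; c1; c2] x &
     tropical_root [tuple c0; c1; c2] y]) ->
  c0 * c2 < c1 ^+ 2.
Proof.
move=> c0_ge0 c1_ge0 c2_gt0 [x [y [xy tx ty]]]; rewrite ltNge; apply/negP => le_c.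
suff H z : tropical_root [tuple c0; c1; c2] z -> 0 <= z /\ c0 = c2 * z ^+ 2.
  have [x0 ex] := H x tx; have [y0 ey] := H y ty.
  move/eqP: xy; apply; apply/eqP; rewrite -(@eqrXn2 _ 2) //.
  by apply/eqP; apply: (mulfI (lt0r_neq0 c2_gt0)); rewrite -ex -ey.
case=> z0 [i [j [ij maxi maxj]]]; split=> //.
have le_f : (c1 * z) ^+ 2 <= c0 * (c2 * z ^+ 2).
  by rewrite exprMn mulrA ler_wpM2r ?sqr_ge0.
have f1 : 0 <= c1 * z by rewrite mulr_ge0.
have f2 : 0 <= c2 * z ^+ 2 by rewrite mulr_ge0 ?sqr_ge0 ?ltW.
pose o0 : 'I_3 := Ordinal (isT : 0 < 3)%N.
pose o1 : 'I_3 := Ordinal (isT : 1 < 3)%N.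
pose o2 : 'I_3 := Ordinal (isT : 2 < 3)%N.
move: (maxi o0) (maxi o1) (maxi o2) (maxj o0) (maxj o1) (maxj o2) ij.
rewrite !(tnth_nth 0) /= expr0 expr1 mulr1 {maxi maxj}.
by case: i => [[|[|[|//]]] /= ?]; case: j => [[|[|[|//]]] /= ?] //;
  rewrite ?expr0 ?expr1 ?mulr1; move: f1 f2 le_f;
  move: (c1 * z) (c2 * z ^+ 2) => g1 g2 *; nra.
Qed.

(** A reordering of [s] close to [t] pairs [t] with [s], whereas [spec_variation]
    permutes [t]: the permutation to use is the inverse one. *)
Lemma spec_variation_le m (s t : m.-tuple C) (t' : seq C) (d : R) :
  0 <= d -> perm_eq t' s ->
  (forall i, (i < m)%N -> normc (nth 0 t' i - nth 0 t i) <= d) ->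
  spec_variation s t <= d.
Proof.
move=> d0 /tuple_permP[p def_t'] le_d.
apply: le_trans (_ : matching_dist s t p^-1%g <= _).
  exact: bigmin_le_cond.
apply: bigmax_le => // j _; have := le_d _ (ltn_ord (p^-1%g j)).
rewrite def_t' -!tnth_nth tnth_mktuple permKV normcBC; exact.
Qed.

End Assembly.

(** * The quadratic eigenvalue problem *)

Section Final.
Variable R : realType.
Local Notation C := R[i].

Lemma powR_invn_exp (x : R) N : (0 < N)%N -> 0 <= x -> (x `^ N%:R^-1) ^+ N = x.
Proof.
move=> N0 x0; rewrite -powR_mulrn ?powR_ge0 // -powRrM mulVf ?pnatr_eq0 ?lt0n_neq0 //.
by rewrite powRr1.
Qed.

(** Extraction of the [N]-th root: the [N]-th power of the right-hand side is
    [4^N / 2] times the right-hand side of the hypothesis. *)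
Lemma le_of_matching_estimate N (u k q S al : R) :
  (0 < N)%N -> 0 <= u -> 0 <= k -> 0 <= q -> 0 <= S -> 0 <= al ->
  2 * (u / 4) ^+ N <= k * q * al * (S * al) ^+ N.-1 ->
  u <= 4 * 2 `^ (- N%:R^-1) * S `^ (1 - N%:R^-1) * k `^ N%:R^-1 * al *
       q `^ N%:R^-1.
Proof.
move=> N0 u0 k0 q0 S0 al0 le_u; set T := _ * q `^ _.
have T0 : 0 <= T by rewrite !mulr_ge0 ?powR_ge0.
rewrite -(@ler_pXn2r _ N) ?nnegrE //.
have N1 : N%:R != 0 :> R by rewrite pnatr_eq0 lt0n_neq0.
have e2 : (2 `^ (- N%:R^-1)) ^+ N = 2^-1 :> R.
  rewrite -powR_mulrn ?powR_ge0 // -powRrM mulNr mulVf //.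
  by rewrite powR_inv1.
have eS : (S `^ (1 - N%:R^-1)) ^+ N = S ^+ N.-1.
  rewrite -powR_mulrn ?powR_ge0 // -powRrM mulrBl mul1r mulVf //.
  by rewrite -[N in LHS]prednK // -natr1 addrK powR_mulrn.
rewrite /T !exprMn e2 eS !powR_invn_exp //.
rewrite exprMn exprVn mulrA ler_pdivrMr ?exprn_gt0 // in le_u.
rewrite -(@ler_pM2l _ 2) //; apply: le_trans le_u _.
have -> : al ^+ N = al * al ^+ N.-1 by rewrite -exprS prednK.
rewrite exprMn.
rewrite le_eqVlt; apply/orP; left; apply/eqP; by field.
Qed.

(** The matching theorem for the companion matrices with and without [A0],
    balanced by the larger tropical root [al].  Here [k] stands for the condition
    number of [A2] and [q] for the inverse of the ratio of the tropical roots. *)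
Lemma quad_spectrum_matching n (A0 A1 A2 : 'M[C]_n) (g0 g1 g2 b2 : R)
    (lambda : (n + n).-tuple C) (xi : n.-tuple C) :
  let k := g2 * b2 in let al := g1 / g2 in let q := g0 / g1 / al in
  (0 < n)%N -> A2 \in unitmx -> 0 <= g0 -> 0 < g1 -> 0 < g2 ->
  mx_bound A0 g0 -> mx_bound A1 g1 -> mx_bound (invmx A2) b2 ->
  is_spec (quad_poly A2 A1 A0) lambda -> is_spec (lin_pencil A2 A1) xi ->
  exists2 t', perm_eq t' lambda & forall i, (i < n + n)%N ->
    2 * (normc (nth 0 t' i - nth 0 (xi ++ nseq n 0) i) / 4) ^+ (n + n) <=
    k * q * al * ((2 + 2 * k + k * q) * al) ^+ (n + n).-1.
Proof.
move=> k al q n0 A2u g0_ge0 g1_gt0 g2_gt0 A0b A1b A2b spec_l spec_xi.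
have al_gt0 : 0 < al by rewrite divr_gt0.
have b2_ge0 : 0 <= b2 := mx_bound_ge0 n0 A2b.
pose U := invmx A2 *m A1; pose V := invmx A2 *m A0.
have Ub : mx_bound U (b2 * g1) by exact: mx_boundM.
have Vb : mx_bound V (b2 * g0) by exact: mx_boundM.
have u0 : 0 <= b2 * g1 by rewrite mulr_ge0 // ltW.
have w0 : 0 <= b2 * g0 by rewrite mulr_ge0.
have al0 : al%:C%C != 0 :> C by rewrite (fmorph_eq0 (real_complex R)) gt_eqF.
have d2 : \det A2 != 0 by rewrite -unitfE -unitmxE.
have zb : mx_bound (0 : 'M[C]_n) 0 by move=> v; rewrite mul0mx l2norm0 mul0r.
have charB : char_poly (companion al%:C%C U V) = monic_of_roots lambda.
  apply: (is_spec_monic_of_roots d2 (char_poly_monic _) _ spec_l).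
  by rewrite det_quad_poly // char_poly_companion.
have charA : char_poly (companion al%:C%C U 0) = monic_of_roots (xi ++ nseq n 0).
  rewrite char_poly_companion0 // /monic_of_roots big_cat /= mulrC.
  congr (_ * _); last by rewrite big_nseq iter_mulr_1 subr0.
  apply: (is_spec_monic_of_roots d2 (char_poly_monic _) _ spec_xi).
  by rewrite det_lin_pencil.
have nn0 : (0 < n + n)%N by rewrite addn_gt0 n0.
have [|t' pt' le_t'] := eigenvalue_matching nn0 _
    (mx_bound_companion al_gt0 Ub zb u0 (lexx 0))
    (mx_bound_companion al_gt0 Ub Vb u0 w0)
    (mx_bound_companionB U al_gt0 Vb w0) charA charB.
  by rewrite lerD2l mul0r divr_ge0 // ltW.
exists t' => // i lt_i; apply: le_trans (le_t' i lt_i) _.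
have g1n : g1 != 0 by rewrite gt_eqF.
have g2n : g2 != 0 by rewrite gt_eqF.
have -> : b2 * g0 / al = k * q * al.
  by rewrite /k /q /al; field; rewrite g1n g2n.
have -> : al + b2 * g1 + 0 / al + (al + b2 * g1 + k * q * al) =
   (2 + 2 * k + k * q) * al.
  rewrite /k /q /al; field; by rewrite g1n g2n.
by [].
Qed.

Lemma pencil_eigenvalue_bounds n (A1 A2 : 'M[C]_n) (g1 g2 b2 : R)
    (xi : n.-tuple C) i :
  A2 \in unitmx -> 0 <= b2 ->
  mx_bound A1 g1 -> mx_bound A2 g2 -> mx_bound (invmx A2) b2 ->
  is_spec (lin_pencil A2 A1) xi ->
  normc (tnth xi i) <= b2 * g1 /\
  forall b1, A1 \in unitmx -> 0 <= b1 -> mx_bound (invmx A1) b1 ->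
    1 <= normc (tnth xi i) * (g2 * b1).
Proof.
move=> A2u b2_ge0 A1b A2b A2Vb spec_xi; set z := tnth xi i.
have d2 : \det A2 != 0 by rewrite -unitfE -unitmxE.
have charU : char_poly (- (invmx A2 *m A1)) = monic_of_roots xi.
  apply: (is_spec_monic_of_roots d2 (char_poly_monic _) _ spec_xi).
  by rewrite det_lin_pencil.
have [|v v0 Uv] := @eigenvector_char_poly _ _ (- (invmx A2 *m A1)) z.
  by rewrite charU root_prod_XsubC mem_tnth.
rewrite -l2norm_gt0 in v0.
have {}Uv : invmx A2 *m A1 *m v = (- z) *: v.
  by rewrite scaleNr -Uv mulNmx opprK.
split.
  have := mx_boundM b2_ge0 A2Vb A1b v.
  by rewrite Uv l2normZ normc_opp ler_pM2r.
move=> b1 A1u b1_ge0 A1Vb; have := mx_boundM b1_ge0 A1Vb A2b (- z *: v).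
rewrite -Uv -!mulmxA mulKVmx // mulKmx // !mulmxA.
have -> : l2norm (invmx A2 *m A1 *m v) = normc z * l2norm v.
  by rewrite Uv l2normZ normc_opp.
rewrite mulrA -[X in X <= _]mul1r ler_pM2r //.
by rewrite [_ * normc z]mulrC [g2 * _]mulrC.
Qed.

End Final.

Theorem theorem2 (R : realType) (n : nat) (n_gt0 : (0 < n)%N)
    (A0 A1 A2 : 'M[R[i]]_n) (A2_unit : A2 \in unitmx)
    (lambda : (n + n).-tuple R[i]) (xi : n.-tuple R[i]) :
  let gamma0 := spectral_norm A0 in
  let gamma1 := spectral_norm A1 in
  let gamma2 := spectral_norm A2 in
  let alpha_plus := gamma1 / gamma2 in
  let alpha_minus := gamma0 / gamma1 in
  let delta : \bar R := (alpha_plus%:E / alpha_minus%:E)%E in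
  let e : R := (2 * n%:R)^-1 in
  let C : \bar R :=
    ((4 * 2 `^ (- e))%:E
     * (2%:E + 2%:E * cond A2 + cond A2 / delta) `^ (1 - e)
     * (cond A2) `^ e)%E in
  (exists x y : R,
     [/\ x != y, tropical_root [tuple gamma0; gamma1; gamma2] x &
                 tropical_root [tuple gamma0; gamma1; gamma2] y]) ->
  is_spec (quad_poly A2 A1 A0) lambda ->
  is_spec (lin_pencil A2 A1) xi ->
  ((spec_variation lambda [tuple of xi ++ nseq n 0])%:E
     <= C * alpha_plus%:E / delta `^ e)%E
  /\ (forall i : 'I_n,
        (alpha_plus%:E * (cond A1)^-1 <= (Normc.normc (tnth xi i))%:E)%E /\
        ((Normc.normc (tnth xi i))%:E <= alpha_plus%:E * cond A2)%E).
Proof.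
move=> g0 g1 g2 al am delta e C trop spec_l spec_xi.
have g0_ge0 : 0 <= g0 := spectral_norm_ge0 A0 n_gt0.
have g1_ge0 : 0 <= g1 := spectral_norm_ge0 A1 n_gt0.
have g2_gt0 : 0 < g2 := spectral_norm_gt0 (unitmx_neq0 n_gt0 A2_unit).
have A0b : mx_bound A0 g0 := @spectral_norm_bound _ _ A0.
have A1b : mx_bound A1 g1 := @spectral_norm_bound _ _ A1.
have A2b : mx_bound A2 g2 := @spectral_norm_bound _ _ A2.
have [b2 [b2_ge0 A2Vb condA2]] :
    exists b2, [/\ 0 <= b2, mx_bound (invmx A2) b2 & cond A2 = (g2 * b2)%:E].
  exists (spectral_norm (invmx A2)); split.
  - exact: spectral_norm_ge0.
  - exact: spectral_norm_bound.
  - by rewrite /cond A2_unit.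
have condA1 : A1 \in unitmx ->
    exists b1, [/\ 0 < b1, mx_bound (invmx A1) b1 & cond A1 = (g1 * b1)%:E].
  move=> A1u; exists (spectral_norm (invmx A1)); split.
  - by apply/spectral_norm_gt0/unitmx_neq0; rewrite // unitmx_inv.
  - exact: spectral_norm_bound.
  - by rewrite /cond A1u.
(* From here on the norms enter only through the bounds just collected. *)
clearbody g0 g1 g2; set k := g2 * b2 in condA2.
have lt_g : g0 * g2 < g1 ^+ 2 := tropical_roots_distinct g0_ge0 g1_ge0 g2_gt0 trop.
have g1_gt0 : 0 < g1.
  rewrite lt_def g1_ge0 andbT; apply: contraTneq lt_g => ->.
  by rewrite expr0n /= -leNgt mulr_ge0 // ltW.
have al_gt0 : 0 < al by rewrite divr_gt0.
pose q := am / al.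
have k_ge0 : 0 <= k by rewrite mulr_ge0 ?(ltW g2_gt0).
have am_ge0 : 0 <= am by rewrite divr_ge0.
have q_ge0 : 0 <= q by rewrite divr_ge0 // ltW.
have e_gt0 : 0 < e by rewrite invr_gt0 mulr_gt0 // ltr0n.
have [deltaV deltaeV] : (delta^-1 = q%:E /\ (delta `^ e)^-1 = (q `^ e)%:E)%E.
  (* If [am = 0], then [delta = +oo], and both inverses are [0], as are [q] and
     [q `^ e]. *)
  have [am0|am_neq0] := eqVneq am 0.
    have -> : delta = +oo%E by rewrite /delta am0 inve0 gt0_muley // lte_fin.
    by rewrite poweRyr ?gt_eqF // invey /q am0 mul0r powR0 // gt_eqF.
  have am_gt0 : 0 < am by rewrite lt_def am_neq0.
  have -> : delta = (q^-1)%:E.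
    by rewrite /delta inver (negbTE am_neq0) -EFinM /q; congr EFin;
      rewrite [RHS]invf_div.
  have q_gt0 : 0 < q by rewrite divr_gt0.
  have qVe : (q^-1 `^ e)^-1 = q `^ e.
    by rewrite -(powR_inv1 (ltW q_gt0)) -powRrM mulN1r powRN invrK.
  by rewrite poweR_EFin !inver invr_eq0 !gt_eqF ?powR_gt0 ?invr_gt0 // invrK qVe.
have kq_ge0 : 0 <= k * q := mulr_ge0 k_ge0 q_ge0.
have S_ge0 : 0 <= 2 + 2 * k + k * q by lra.
split; last first.
  move=> i.
  have [up low] := pencil_eigenvalue_bounds i A2_unit b2_ge0 A1b A2b A2Vb spec_xi.
  split.
    have [A1u|A1s] := boolP (A1 \in unitmx); last first.
      by rewrite /cond (negbTE A1s) invey mule0 lee_fin normc_ge0.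
    have [b1 [b1_gt0 A1Vb ->]] := condA1 A1u.
    have le1 := low b1 A1u (ltW b1_gt0) A1Vb.
    rewrite inver gt_eqF ?mulr_gt0 // -EFinM lee_fin.
    have -> : al / (g1 * b1) = 1 / (g2 * b1).
      by rewrite /al; field; rewrite !gt_eqF.
    by rewrite ler_pdivrMr ?mulr_gt0.
  rewrite condA2 -EFinM lee_fin; apply: le_trans up _.
  by rewrite le_eqVlt /al /k; apply/orP; left; apply/eqP; field; rewrite gt_eqF.
have Sfin : (2%:E + 2%:E * k%:E + k%:E * q%:E)%E = (2 + 2 * k + k * q)%:E.
  by rewrite !EFinD !EFinM.
rewrite deltaeV /C condA2 deltaV Sfin !poweR_EFin -!EFinM lee_fin.
have [t' pt' le_t'] := quad_spectrum_matching n_gt0 A2_unit g0_ge0 g1_gt0 g2_gt0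
  A0b A1b A2Vb spec_l spec_xi.
have nn0 : (0 < n + n)%N by rewrite addn_gt0 n_gt0.
have eN : e = (n + n)%:R^-1 by rewrite /e natrD mulrDl mul1r.
apply: spec_variation_le pt' _.
  by rewrite !mulr_ge0 ?powR_ge0 ?invr_ge0 ?(ltW g2_gt0).
move=> i lt_i; rewrite eN; apply: le_of_matching_estimate;
  rewrite ?normc_ge0 ?(ltW al_gt0) //.
exact: le_t'.
Qed.
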